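(* Let $k\ge 2$ and $0\le n\le k$ be integers. In each of the following cases, $\gamma_{k,n}(q)$ vanishes for at least one real value $q\in\,]-1,0[$: (a) $n\equiv 0 \pmod 4$ and $k$ is congruent modulo $8$ to $3$, $4$ or $5$; (b) $n\equiv 1 \pmod 4$ and $k$ is congruent modulo $8$ to $5$, $6$ or $7$; (c) $n\equiv 2 \pmod 4$ and $k$ is congruent modulo $8$ to $7$, $0$ or $1$; (d) $n\equiv 3 \pmod 4$ and $k$ is congruent modulo $8$ to $1$, $2$ or $3$. Moreover, the disjunction of these conditions is equivalent to the single condition that $k-2n$ is congruent modulo $8$ to $3$, $4$ or $5$.
   Context: For $q\in\mathbb{C}$ with $0<|q|<1$, an integer $k\ge1$ and $n\in\mathbb{Z}$, $$\gamma_{k,n}(q) := \sum_{\substack{m_1,\ldots,m_k\in\mathbb{Z}\\ m_1+\cdots+m_k=n}} q^{(m_1(m_1-1)+\cdots+m_k(m_k-1))/2};$$ equivalently, $\gamma_{k,n}(q)$ is the coefficient of $x^n$ in the Laurent expansion on $\mathbb{C}^*$ of $\theta_q(x)^k$, where $\theta_q(x):=\sum_{m\in\mathbb{Z}} q^{m(m-1)/2}x^m$. *)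

(* Defs.v *)
From HB Require Import structures.
From mathcomp Require Import all_boot all_order all_algebra.
From mathcomp Require Import all_classical all_reals topology normedtype.
From mathcomp Require Import complex.
From mathcomp Require summability.

Set Implicit Arguments.
Unset Strict Implicit.
Unset Printing Implicit Defensive.

Import Order.TTheory GRing.Theory Num.Theory.
Import numFieldNormedType.Exports.

Local Open Scope ring_scope.
Local Open Scope complex_scope.

(* [summability.sum] is the unordered sum: the limit of the finite partial sums
   along the directed set of finite subsets of the index type.  It is meaningful
   for 0 < |q| < 1, where the family is absolutely summable (as with every [lim],
   a divergent family would be given the default value 0).  The integer quotient
   by 2 is exact, since each m_i (m_i - 1) is even. *)
Definition gamma (R : realType) (k : nat) (n : int) (q : R[i]) : R[i] :=
  summability.sum (R := R[i]^o)
    (fun m : {m : {ffun 'I_k -> int} | \sum_(i < k) m i == n} =>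
       q ^ ((\sum_(i < k) val m i * (val m i - 1)) %/ 2)%Z).

Definition case_a (k n : nat) : Prop :=
  n = 0 %[mod 4] /\ (k = 3 %[mod 8] \/ k = 4 %[mod 8] \/ k = 5 %[mod 8]).

Definition case_b (k n : nat) : Prop :=
  n = 1 %[mod 4] /\ (k = 5 %[mod 8] \/ k = 6 %[mod 8] \/ k = 7 %[mod 8]).

Definition case_c (k n : nat) : Prop :=
  n = 2 %[mod 4] /\ (k = 7 %[mod 8] \/ k = 0 %[mod 8] \/ k = 1 %[mod 8]).

Definition case_d (k n : nat) : Prop :=
  n = 3 %[mod 4] /\ (k = 1 %[mod 8] \/ k = 2 %[mod 8] \/ k = 3 %[mod 8]).

(* Main.v *)
Require Import Defs.
From HB Require Import structures.
From mathcomp Require Import all_boot all_order all_algebra.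
From mathcomp Require Import finmap.
From mathcomp Require Import all_classical all_reals topology normedtype.
From mathcomp Require Import complex.
From mathcomp Require Import derive ring lra zify.
From mathcomp Require summability.

Import Order.TTheory GRing.Theory Num.Theory.
Import numFieldNormedType.Exports.
Local Open Scope ring_scope.
Local Open Scope complex_scope.

(* Let F(q) be the real sum of q ^ Q(m) over the integer points m with
   m_1 + ... + m_k = n, where Q(m) is the sum of the m_i (m_i - 1) / 2.  F is
   continuous on ]-1, 1[ and F(0) >= 1, so by the intermediate value theorem it
   is enough to find r in ]0, 1[ with F(-r) < 0.  Now (-r) ^ Q(m) is r ^ Q(m)
   times the product of the signs (-1) ^ (m_i (m_i - 1) / 2), which depend on
   m_i mod 4.  As r tends to 1 the weights r ^ Q(m) become equidistributed: the
   shift m_a := m_a + 1, m_b := m_b - 1 changes them by a total variation that is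
   negligible with respect to F(r).  Hence the signs can be averaged along such
   shifts, one coordinate after the other, and F(-r) / F(r) tends to
   2 ^ (1 - k / 2) * cos (pi (k - 2n) / 4), which is negative exactly when
   k - 2n is 3, 4 or 5 modulo 8. *)

(* Unordered sums of absolutely summable real families *)
#[local] Existing Instance summability.totally_filter.

Section UnorderedSums.
Variables (R : realType) (I : choiceType).
Implicit Types (f g h : I -> R) (J : {fset I}).

Local Notation tot := (@summability.totally I).

Definition psum f J : R := \sum_(i <- J) f i.
Definition abs_summable f := exists M, forall J, psum (fun i => `|f i|) J <= M.
Definition usum f : R := lim (psum f @ tot)%classic.

Lemma psum_le f J J' :
  (forall i, 0 <= f i) -> (J `<=` J')%fset -> psum f J <= psum f J'.
Proof.
move=> f0 JJ'; rewrite /psum (big_fsetID _ (mem J) J') /=.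
have -> : [fset x in J' | x \in J]%fset = J.
  by apply/fsetP => x; rewrite !inE /=; case: (boolP (x \in J)) => [/(fsubsetP JJ') ->|]; rewrite ?andbF.
by rewrite lerDl sumr_ge0.
Qed.

Lemma nneg_cvg f : (forall i, 0 <= f i) -> (exists M, forall J, psum f J <= M) ->
  (psum f @ tot --> sup (range (psum f)))%classic.
Proof.
move=> f0 [M HM].
have hs : has_sup (range (psum f)).
  split; first by exists (psum f fset0), fset0.
  by exists M => _ [J _ <-].
apply/cvgrPdist_le => e e0.
have [_ [J0 _ <-] HJ0] := sup_adherent e0 hs.
exists J0 => // J J0J /=; rewrite ger0_norm ?subr_ge0.
  by rewrite lerBlDr -lerBlDl (le_trans (ltW HJ0))// psum_le.
by apply: sup_upper_bound => //; exists J.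
Qed.

Lemma psumD f g J : psum (fun i => f i + g i) J = psum f J + psum g J.
Proof. exact: big_split. Qed.

Lemma psumZ c f J : psum (fun i => c * f i) J = c * psum f J.
Proof. by rewrite /psum mulr_sumr. Qed.

Lemma ler_psum f g J : (forall i, f i <= g i) -> psum f J <= psum g J.
Proof. by move=> fg; apply: ler_sum. Qed.

Lemma abs_summable_le f g : abs_summable g -> (forall i, `|f i| <= g i) ->
  abs_summable f.
Proof.
move=> [M HM] fg; exists M => J; apply: le_trans (HM J); apply: ler_psum => i.
exact: le_trans (fg i) (ler_norm _).
Qed.

Lemma abs_summableD f g : abs_summable f -> abs_summable g ->
  abs_summable (fun i => f i + g i).
Proof.
move=> [M HM] [N HN]; exists (M + N) => J.
apply: le_trans (lerD (HM J) (HN J)); rewrite -psumD; apply: ler_psum => i.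
exact: ler_normD.
Qed.

Lemma abs_summableMl f h (C : R) : abs_summable f -> (forall i, `|h i| <= C) ->
  abs_summable (fun i => f i * h i).
Proof.
move=> [M HM] hC; exists (`|C| * M) => J.
apply: le_trans (ler_wpM2l (normr_ge0 _) (HM J)); rewrite -psumZ.
apply: ler_psum => i; rewrite normrM mulrC ler_wpM2r//.
exact: le_trans (hC i) (ler_norm _).
Qed.

Lemma abs_summable_norm f : abs_summable f -> abs_summable (fun i => `|f i|).
Proof. by move=> [M HM]; exists M => J; under eq_fun do rewrite normr_id. Qed.

(** Write [f] as the difference of [f + |f|] and [|f|]: both are nonnegative with bounded partial
    sums, so [nneg_cvg] applies to each. *)
Lemma usum_cvg f : abs_summable f -> (psum f @ tot --> usum f)%classic.
Proof.
move=> [M HM].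
have c1 := nneg_cvg _ (fun i => normr_ge0 (f i)) (ex_intro _ M HM).
have h0 i : 0 <= f i + `|f i| by rewrite -lerBlDl sub0r -normrN ler_norm.
have hM : exists N, forall J, psum (fun i => f i + `|f i|) J <= N.
  exists (M + M) => J; rewrite psumD lerD//; apply: le_trans (HM J).
  by apply: ler_psum => i; exact: ler_norm.
have c2 := nneg_cvg _ h0 hM.
suff : cvg (psum f @ tot)%classic by [].
have -> : psum f = (fun J => psum (fun i => f i + `|f i|) J - psum (fun i => `|f i|) J).
  by apply/funext => J; rewrite psumD addrK.
by apply/cvg_ex; eexists; exact: (cvgB c2 c1).
Qed.

Lemma usum_unique f l : (psum f @ tot --> l)%classic -> usum f = l.
Proof. exact: cvg_lim. Qed.

Lemma usumD f g : abs_summable f -> abs_summable g ->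
  usum (fun i => f i + g i) = usum f + usum g.
Proof.
move=> sf sg; apply: usum_unique.
rewrite (_ : psum _ = fun J => psum f J + psum g J).
  exact: cvgD (usum_cvg _ sf) (usum_cvg _ sg).
by apply/funext => J; rewrite psumD.
Qed.

Lemma usumZ c f : abs_summable f -> usum (fun i => c * f i) = c * usum f.
Proof.
move=> sf; apply: usum_unique.
rewrite (_ : psum _ = fun J => c * psum f J).
  exact: cvgM (cvg_cst c) (usum_cvg _ sf).
by apply/funext => J; rewrite psumZ.
Qed.

Lemma usum_ge0 f : abs_summable f -> (forall i, 0 <= f i) -> 0 <= usum f.
Proof.
move=> sf f0; apply: limr_ge; first exact: usum_cvg.
by exists fset0 => // J _; exact: sumr_ge0.
Qed.

Lemma abs_summableZ c f : abs_summable f -> abs_summable (fun i => c * f i).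
Proof.
move=> sf; under eq_fun do rewrite mulrC.
by apply: (abs_summableMl _ _ `|c|) => // i.
Qed.

Lemma usumB f g : abs_summable f -> abs_summable g ->
  usum (fun i => f i - g i) = usum f - usum g.
Proof.
move=> sf sg; under eq_fun do rewrite -mulN1r.
by rewrite usumD ?usumZ ?mulN1r//; exact: abs_summableZ.
Qed.

Lemma ler_usum f g : abs_summable f -> abs_summable g -> (forall i, f i <= g i) ->
  usum f <= usum g.
Proof.
move=> sf sg fg; rewrite -subr_ge0 -usumB//; apply: usum_ge0.
  by under eq_fun do rewrite -mulN1r; apply: abs_summableD => //; exact: abs_summableZ.
by move=> i; rewrite subr_ge0.
Qed.

Lemma psum_le_usum f J : abs_summable f -> (forall i, 0 <= f i) -> psum f J <= usum f.
Proof.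
move=> sf f0; apply: limr_ge; first exact: usum_cvg.
by exists J => // J' JJ'; exact: psum_le.
Qed.

Lemma ler_norm_usum f g : abs_summable g -> (forall i, `|f i| <= g i) ->
  `|usum f| <= usum g.
Proof.
move=> sg fg; have sf := abs_summable_le _ _ sg fg.
have sNg : abs_summable (fun i => -1 * g i).
  by apply: abs_summable_le sg _ => i; rewrite mulN1r normrN ger0_norm// (le_trans _ (fg i)).
rewrite ler_norml -mulN1r -usumZ//; apply/andP; split; apply: ler_usum => // i.
  by rewrite mulN1r lerNl (le_trans _ (fg i))// -normrN ler_norm.
by rewrite (le_trans _ (fg i))// ler_norm.
Qed.

Lemma usum_fset f J : usum (fun i => f i * (i \in J)%:R) = psum f J.
Proof.
apply/usum_unique; apply: cvg_near_cst; exists J => // J' /= JJ'.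
rewrite /psum (big_fsetID _ (mem J) J')/= [X in _ + X]big1_fset ?addr0.
- apply: eq_fbig => i.
    by rewrite !inE /=; case: (boolP (i \in J)) => [/(fsubsetP JJ') ->|]; rewrite ?andbF.
  by rewrite !inE => /andP[_ /= ->]; rewrite mulr1.
- by move=> i; rewrite !inE => /andP[_ /negbTE ->]; rewrite mulr0.
Qed.

(** One finite set serves every family dominated by [g], because the remainder of each is at most
    the remainder of [g]. This uniformity is what makes [qsum] continuous. *)
Lemma usum_tail g e : abs_summable g -> 0 < e ->
  exists J, forall f, (forall i, `|f i| <= g i) -> `|usum f - psum f J| <= e.
Proof.
move=> sg e0.
have [J _ /(_ J (fsubset_refl _)) /= HJ] := (cvgrPdist_le _ _).1 (usum_cvg _ sg) _ e0.
have tailE h : abs_summable h -> usum h - psum h J = usum (fun i => h i * (i \notin J)%:R)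
    /\ abs_summable (fun i => h i * (i \notin J)%:R).
  move=> sh; have sC (b : I -> bool) : abs_summable (fun i => h i * (b i)%:R).
    by apply: (abs_summableMl _ _ 1) => // i; case: (b i); rewrite ?normr1 ?normr0.
  split=> //; rewrite -usum_fset -usumB//.
  by congr usum; apply/funext => i; case: (i \in J); rewrite /= ?mulr1 ?mulr0; lra.
exists J => f fg; have sf := abs_summable_le _ _ sg fg.
have [fE _] := tailE _ sf; have [gE sgJ] := tailE _ sg.
rewrite fE; apply: le_trans (le_trans _ HJ); last exact: ler_norm.
rewrite gE; apply: ler_norm_usum => // i.
by rewrite normrM normr_nat ler_wpM2r.
Qed.

(** A finite set that contains the [t]-image of [J0] has an [s]-image that contains [J0], so taking
    images under [s] respects the filter of finite subsets. *)
Lemma usum_reindex f (s t : I -> I) : cancel s t -> cancel t s -> abs_summable f ->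
  abs_summable (fun i => f (s i)) /\ usum (fun i => f (s i)) = usum f.
Proof.
move=> st ts sf.
have pE (h : I -> R) J : psum (fun i => h (s i)) J = psum h [fset s i | i in J]%fset.
  by rewrite /psum big_imfset//= => i j _ _; exact: (can_inj st).
split; first by case: sf => M HM; exists M => J; rewrite (pE (fun i => `|f i|)).
apply: usum_unique.
rewrite (_ : psum _ = fun J => psum f [fset s i | i in J]%fset); last first.
  by apply/funext => J; rewrite pE.
have h : ((fun J : {fset I} => [fset s i | i in J]%fset) @ tot --> tot)%classic.
  move=> P [J0 _ HJ0]; exists [fset t i | i in J0]%fset => // J J0J /=.
  apply: HJ0 => /=; apply/fsubsetP => i iJ; apply/imfsetP; exists (t i) => /=; last by rewrite ts.
  by apply: (fsubsetP J0J); apply/imfsetP; exists i.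
exact: (cvg_comp _ _ h (usum_cvg _ sf)).
Qed.
End UnorderedSums.

Arguments psum {R I}.
Arguments abs_summable {R I}.
Arguments usum {R I}.

(** * Variation of the weights under a unit shift *)

Section Shift.
Variables (R : realType) (K : nat).

(* The difference d of the two shifted coordinates, truncated to [-K, K], is the
   test function that bounds the total variation of the weights: summation by
   parts gives Sum w (1 - r ^ (d + 1)) clamp(d) <= 2 Sum w, and the terms with
   |d| < K are small when r is close to 1. *)
Definition clamp (x : int) : int := Num.max (- K%:Z) (Num.min K%:Z x).

Lemma clamp_bound x : `|(clamp x)%:~R : R| <= K%:R.
Proof.
have : `|clamp x|%:~R <= (K%:Z)%:~R :> R by rewrite ler_int /clamp; lia.
by rewrite intr_norm.
Qed.

Lemma clampD2 x : (clamp (x + 2))%:~R - (clamp x)%:~R <= 2 :> R.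
Proof.
have : (clamp (x + 2) - clamp x)%:~R <= (2%:Z)%:~R :> R by rewrite ler_int /clamp; lia.
by rewrite intrB.
Qed.

(** If |x + 1| <= K, the term [r ^- K - 1] suffices, the other one being nonnegative. Otherwise
    [clamp K x] is K or -K, and the first term on the right already equals the left-hand side. *)
Lemma exprz_near1 (r : R) (x : int) : 0 < r -> r < 1 -> (0 < K)%N ->
  `|r ^ (x + 1) - 1| <= K%:R^-1 * ((clamp x)%:~R * (1 - r ^ (x + 1))) + (r ^- K - 1).
Proof.
move=> r0 r1 K0; have K0R : 0 < K%:R :> R by rewrite ltr0n.
have rK n : (n <= K)%N -> r ^- n <= r ^- K.
  by move=> nK; rewrite lef_pV2 ?posrE ?exprn_gt0// ler_wiXn2l// ltW.
have rK1 : 1 <= r ^- K by rewrite -[1]invr1 -(expr0 r); exact: rK.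
have Kr_ge0 (c : int) (y : R) : 0 <= c -> 0 <= y -> 0 <= K%:R^-1 * (c%:~R * y).
  by move=> c0 y0; rewrite !mulr_ge0 ?invr_ge0 ?ler0n ?ler0z.
case E: (x + 1) => [n|n].
  set y := r ^ n%:Z.
  have y0 : 0 < y by rewrite exprn_gt0.
  have y1 : y <= 1 by rewrite exprn_ile1// ltW.
  rewrite ler0_norm ?subr_le0// opprB.
  have [nK|Kn] := leqP n K.
    rewrite -[leLHS]add0r lerD//.
      (* For n = 0, x is -1 and its clamp is negative, but the factor 1 - y vanishes. *)
      case: n E @y y0 y1 nK => [|n] E y y0 y1 nK; first by rewrite /y expr0z subrr !mulr0.
      by apply: Kr_ge0; rewrite ?subr_ge0// /clamp; lia.
    apply: (@le_trans _ _ (y^-1 - 1)); last by rewrite lerD2r; exact: rK.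
    (* After multiplication by y this is (1 - y)^2 >= 0. *)
    rewrite -(ler_pM2r y0) !mulrBl mulVf ?gt_eqF//; nra.
  have -> : clamp x = K%:Z by rewrite /clamp; lia.
  by rewrite mulrA mulVf ?gt_eqF// mul1r lerDl subr_ge0.
set y := r ^ (Negz n).
have yE : y = r ^- n.+1 by rewrite /y NegzE.
have y1 : 1 <= y.
  by rewrite yE -[leLHS]invr1 lef_pV2 ?posrE ?exprn_gt0// exprn_ile1// ltW.
rewrite ger0_norm ?subr_ge0//.
have -> : (clamp x)%:~R * (1 - y) = (- clamp x)%:~R * (y - 1) :> R.
  by rewrite intrN; ring.
have [nK|Kn] := leqP n.+1 K.
  rewrite -[leLHS]add0r lerD//.
    by apply: Kr_ge0; rewrite ?subr_ge0// /clamp; lia.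
  by rewrite lerD2r yE; exact: rK.
have -> : - clamp x = K%:Z by rewrite /clamp; lia.
by rewrite mulrA mulVf ?gt_eqF// mul1r lerDl subr_ge0.
Qed.
End Shift.

Lemma abs_summableB (R : realType) (I : choiceType) (f g : I -> R) :
  abs_summable f -> abs_summable g -> abs_summable (fun i => f i - g i).
Proof.
move=> sf sg; under eq_fun do rewrite -mulN1r.
by apply: abs_summableD => //; exact: abs_summableZ.
Qed.

Section ShiftVariation.
Variables (R : realType) (I : choiceType) (r : R) (K : nat).
Variables (w : I -> R) (d : I -> int) (s t : I -> I).
Hypotheses (r0 : 0 < r) (r1 : r < 1) (K0 : (0 < K)%N).
Hypotheses (w0 : forall i, 0 <= w i) (sw : abs_summable w).
Hypotheses (st : cancel s t) (ts : cancel t s).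
Hypotheses (ws : forall i, w (s i) = w i * r ^ (d i + 1)).
Hypotheses (ds : forall i, d (s i) = d i + 2).

(** Sum [exprz_near1] against [w]. Reindexing by [s] replaces the sum of w g by that of (w o s)(g o
    s), and g o s - g <= 2 bounds the main term by twice the sum of w. *)
Lemma shift_variation :
  usum (fun i => `|w (s i) - w i|) <= (2 / K%:R + (r ^- K - 1)) * usum w.
Proof.
pose g i : R := (clamp K (d i))%:~R.
have [sws usws] := usum_reindex _ _ w _ _ st ts sw.
have gb i : `|g i| <= K%:R by exact: clamp_bound.
have swg : abs_summable (fun i => w i * g i) by exact: (abs_summableMl _ _ _ _ _ sw gb).
have [swsgs uswsgs] := usum_reindex _ _ _ _ _ st ts swg.
have swsg : abs_summable (fun i => w (s i) * g i).
  exact: (abs_summableMl _ _ _ _ _ sws gb).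
have key : usum (fun i => w i * g i - w (s i) * g i) <= 2 * usum w.
  rewrite usumB// -uswsgs -usumB// -usws -usumZ//; apply: ler_usum => //.
  - by apply: abs_summableB.
  - exact: abs_summableZ.
  - move=> i; rewrite -mulrBr mulrC; apply: ler_wpM2r => //.
    by rewrite /g ds; exact: clampD2.
have pw i : `|w (s i) - w i| <=
    K%:R^-1 * (w i * g i - w (s i) * g i) + (r ^- K - 1) * w i.
  rewrite ws -{2}[w i]mulr1 -mulrBr normrM ger0_norm//.
  apply: le_trans (ler_wpM2l (w0 i) (exprz_near1 _ _ _ (d i) r0 r1 K0)) _.
  by rewrite le_eqVlt; apply/orP; left; apply/eqP; rewrite /g; ring.
have sR : abs_summable (fun i =>
    K%:R^-1 * (w i * g i - w (s i) * g i) + (r ^- K - 1) * w i).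
  by apply: abs_summableD; apply: abs_summableZ => //; exact: abs_summableB.
apply: le_trans (ler_usum _ _ _ _ _ sR pw) _.
  by apply: abs_summable_norm; exact: abs_summableB.
rewrite usumD ?usumZ//; try (apply: abs_summableZ => //; exact: abs_summableB); try exact: abs_summableB.
by rewrite [leRHS]mulrDl lerD2r [2 / _]mulrC -mulrA ler_wpM2l// invr_ge0.
Qed.

(** Since w h and (w o s)(h o s) have the same sum, the difference is the sum of (w o s - w)(h o s)
    / 2, which the variation bounds. *)
Lemma shift_average (h : I -> R) : (forall i, `|h i| <= 1) ->
  `|usum (fun i => w i * h i) - usum (fun i => w i * ((h i + h (s i)) / 2))|
    <= (2 / K%:R + (r ^- K - 1)) * usum w.
Proof.
move=> h1; apply: le_trans shift_variation.
have [sws usws] := usum_reindex _ _ w _ _ st ts sw.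
have swh : abs_summable (fun i => w i * h i) by exact: (abs_summableMl _ _ _ _ 1 sw).
have swhs : abs_summable (fun i => w i * h (s i)).
  by apply: (abs_summableMl _ _ _ (fun i => h (s i)) 1 sw).
have [swshs uswshs] := usum_reindex _ _ _ _ _ st ts swh.
have sd : abs_summable (fun i => w (s i) - w i) by exact: abs_summableB.
have -> : usum (fun i => w i * h i) -
    usum (fun i => w i * ((h i + h (s i)) / 2)) =
    usum (fun i => (w (s i) - w i) * (h (s i) / 2)).
  have -> : (fun i => w i * ((h i + h (s i)) / 2)) =
      (fun i => 2^-1 * (w i * h i + w i * h (s i))) by apply/funext => i; field.
  have -> : (fun i => (w (s i) - w i) * (h (s i) / 2)) =
      (fun i => 2^-1 * (w (s i) * h (s i) - w i * h (s i))) by apply/funext => i; field.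
  have sA := abs_summableD _ _ _ _ swh swhs.
  have sB := abs_summableB _ _ _ _ swshs swhs.
  rewrite !usumZ// usumD// usumB//.
  by rewrite uswshs; field.
apply: ler_norm_usum; first exact: abs_summable_norm.
move=> i; rewrite normrM ler_piMr// normrM (le_trans (ler_wpM2r _ (h1 _)))//.
by rewrite mul1r ger0_norm; lra.
Qed.
End ShiftVariation.

(** * Triangular numbers, the signs they carry, and averages of these signs *)

Definition tri (x : int) : int := ((x * (x - 1)) %/ 2)%Z.

Lemma tri2E x : 2 * tri x = x * (x - 1).
Proof.
have [->|->] : x = 2 * (x %/ 2)%Z \/ x = 2 * (x %/ 2)%Z + 1 by lia.
  by rewrite /tri -mulrA mulKz.
rewrite /tri addrK [X in (X %/ 2)%Z]mulrC -mulrA mulKz//; ring.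
Qed.

Lemma tri_ge0 x : 0 <= tri x.
Proof. have := tri2E x; nia. Qed.

Lemma triD1 x : tri (x + 1) = tri x + x.
Proof. by apply: (@mulfI _ 2) => //; rewrite mulrDr !tri2E; ring. Qed.

Section Signs.
Variable R : realType.

Definition tsgn (x : int) : R := (-1) ^ tri x.

(* The mean of the product of j + 1 signs over all residues mod 4 with sum p.  It
   equals 2 ^ (1 - (j + 1) / 2) * cos (pi (j + 1 - 2 p) / 4). *)
Fixpoint tavg (j : nat) (p : int) : R :=
  if j is j'.+1 then (tavg j' p + tavg j' (p - 1)) / 2 else tsgn p.

(** The exponent grows by 2x + 1, which is odd. *)
Lemma tsgnD2 x : tsgn (x + 2) = - tsgn x.
Proof.
have E : (-1 : R) ^ (2 * x) = 1.
  by rewrite -exprz_exp (_ : (-1) ^ 2%:Z = 1) ?exp1rz// -exprnP sqrrN expr1n.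
rewrite /tsgn (_ : tri (x + 2) = tri x + 1 + 2 * x).
  by rewrite !expfzDr ?oppr_eq0 ?oner_eq0// E mulr1 expr1z mulrN1.
by apply: (@mulfI _ 2) => //; rewrite !mulrDr !tri2E; ring.
Qed.

Lemma tavgD2 j p : tavg j (p + 2) = - tavg j p.
Proof.
elim: j p => [|j IH] p /=; first exact: tsgnD2.
by rewrite [p + 2 - 1]addrAC !IH; field.
Qed.

Lemma tsgn_norm x : `|tsgn x| = 1.
Proof.
by rewrite /tsgn; case: (tri x) => n; rewrite ?NegzE ?exprnN ?normfV normrX normrN1 expr1n ?invr1.
Qed.

Lemma tavg_bound j p : `|tavg j p| <= 1.
Proof.
elim: j p => [|j IH] p /=; first by rewrite tsgn_norm.
have := IH p; have := IH (p - 1); rewrite !ler_norml; lra.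
Qed.

(** Induction in both directions on pairs of consecutive values; identities between signs thus need
    checking only at 0 and 1. *)
Lemma anti_eq (f g : int -> R) : (forall x, f (x + 2) = - f x) ->
  (forall x, g (x + 2) = - g x) -> f 0 = g 0 -> f 1 = g 1 -> f =1 g.
Proof.
move=> fD gD f0 f1.
have H (x : int) : f x = g x /\ f (x + 1) = g (x + 1).
  elim/int_rect: x => [|n [IH1 IH2]|n [IH1 IH2]]; first by rewrite add0r.
    rewrite (_ : n.+1%:Z = n%:Z + 1); last by lia.
    by rewrite -addrA fD gD IH1 IH2.
  have E : - n.+1%:Z + 1 = - n%:Z by lia.
  rewrite E IH1; split=> //; apply: oppr_inj; rewrite -fD -gD.
  by rewrite (_ : - n.+1%:Z + 2 = - n%:Z + 1)//; lia.
by move=> x; have [] := H x.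
Qed.

Lemma tsgn0 : tsgn 0 = 1. Proof. by rewrite /tsgn /tri. Qed.
Lemma tsgn1 : tsgn 1 = 1. Proof. by rewrite /tsgn /tri. Qed.

(** This is the effect of a shift that moves one unit from a new coordinate m into the part already
    averaged, of sum p. Both sides change sign under m := m + 2, so m = 0 and m = 1 decide. *)
Lemma tavg_step j p m :
  (tavg j p * tsgn m + tavg j (p + 1) * tsgn (m - 1)) / 2 = tavg j.+1 (p + m).
Proof.
apply: (anti_eq (fun m => (tavg j p * tsgn m + tavg j (p + 1) * tsgn (m - 1)) / 2)
  (fun m => tavg j.+1 (p + m))) => [x|x||].
- by rewrite [x + 2 - 1]addrAC !tsgnD2; field.
- by rewrite addrA tavgD2.
- have := tsgnD2 (-1); rewrite (_ : -1 + 2 = 1 :> int)// sub0r tsgn1 tsgn0 addr0 /=.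
  have := tavgD2 j (p - 1); rewrite (_ : p - 1 + 2 = p + 1); last by lia.
  by move=> -> /(congr1 (@GRing.opp _)); rewrite opprK => <-; field.
- by rewrite subrr tsgn0 tsgn1 /= addrK; field.
Qed.

(** Two recursion steps give the values at p, p - 1, p - 2 with weights 1/4, 1/2, 1/4, and the outer
    two cancel by [tavgD2]. *)
Lemma tavgSS j p : tavg j.+2 p = tavg j (p - 1) / 2.
Proof.
rewrite /= (_ : p = p - 1 - 1 + 2); last by lia.
by rewrite tavgD2 (_ : p - 1 - 1 + 2 - 1 = p - 1); [field|lia].
Qed.

Lemma tavg_closed i b p : tavg (b + i.*2) p = tavg b (p - i%:Z) / 2 ^+ i.
Proof.
elim: i p => [|i IH] p; first by rewrite addn0 subr0 expr0 divr1.
rewrite doubleS !addnS tavgSS IH exprSr.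
rewrite (_ : p - 1 - i%:Z = p - i.+1%:Z); last by lia.
by rewrite -mulrA -invfM.
Qed.

Lemma tsgn_val (c : int) : tsgn (4 * c) = 1 /\ tsgn (4 * c + 1) = 1.
Proof.
have H y : tsgn (y + 4) = tsgn y.
  by rewrite (_ : y + 4 = y + 2 + 2) ?tsgnD2 ?opprK//; lia.
elim/int_rect: c => [|n [IH1 IH2]|n [IH1 IH2]].
- by rewrite mulr0 add0r tsgn0 tsgn1.
- rewrite (_ : 4 * n.+1%:Z = 4 * n%:Z + 4); last by lia.
  by rewrite addrAC !H.
- rewrite -H -(H (_ + 1)) addrAC (_ : 4 * - n.+1%:Z + 4 = 4 * - n%:Z)//; lia.
Qed.

Lemma tsgn_neg p : (p = 2 %[mod 4])%Z \/ (p = 3 %[mod 4])%Z -> tsgn p = -1.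
Proof.
have [h0 h1] := tsgn_val (p %/ 4)%Z => h.
have [->|->] : p = 4 * (p %/ 4)%Z + 2 \/ p = 4 * (p %/ 4)%Z + 1 + 2 by lia.
  by rewrite tsgnD2 h0.
by rewrite tsgnD2 h1.
Qed.

(** Put i = (k - 1)./2 and p = n - i. For odd k the sign of the average is that of [tsgn p], with p
    = 2 or 3 modulo 4; for even k the two signs at p and p - 1 are averaged, and p = 3 modulo 4
    makes both -1. *)
Lemma tavg_neg (k n : nat) : (0 < k)%N ->
  (k%:Z - 2 * n%:Z = 3 %[mod 8])%Z \/
  (k%:Z - 2 * n%:Z = 4 %[mod 8])%Z \/
  (k%:Z - 2 * n%:Z = 5 %[mod 8])%Z -> tavg k.-1 n%:Z < 0.
Proof.
move=> k0 hk; rewrite -(odd_double_half k.-1) tavg_closed.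
rewrite pmulr_llt0 ?invr_gt0 ?exprn_gt0//.
case E: (odd k.-1) => /=; last by rewrite tsgn_neg; [rewrite oppr_lt0|lia].
rewrite !tsgn_neg; [lra|lia|lia].
Qed.
End Signs.

(** * Integer points with prescribed coordinate sum, and shifts between them *)

Local Notation slice k n := {m : {ffun 'I_k -> int} | \sum_(i < k) m i == n}.

Section Lattice.
Variables (k : nat) (n : int).
Implicit Types (m : {ffun 'I_k -> int}) (a b : 'I_k).

Definition qform m : int := \sum_(i < k) tri (m i).

Lemma qform_ge0 m : 0 <= qform m.
Proof. by apply: sumr_ge0 => i _; exact: tri_ge0. Qed.

Lemma qformE m : ((\sum_(i < k) m i * (m i - 1)) %/ 2)%Z = qform m.
Proof.
rewrite (_ : \sum_(i < k) _ = 2 * qform m); first by rewrite mulKz.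
by rewrite /qform mulr_sumr; apply: eq_bigr => i _; rewrite tri2E.
Qed.

Definition ffshift a b m : {ffun 'I_k -> int} :=
  [ffun i => m i + (i == a)%:R - (i == b)%:R].

Lemma sum_delta (c : int) a : \sum_(i < k) (i == a)%:R * c = c.
Proof.
rewrite (bigD1 a)//= eqxx mul1r big1 ?addr0// => i /negbTE ->.
by rewrite mul0r.
Qed.

Lemma sum_ffshift a b m : \sum_(i < k) ffshift a b m i = \sum_(i < k) m i.
Proof.
under eq_bigr do rewrite ffunE -[(_ == a)%:R]mulr1 -[(_ == b)%:R]mulr1.
by rewrite sumrB big_split/= !sum_delta addrK.
Qed.

(** Only the coordinates a and b contribute, by m a and -(m b - 1). The change depends on m a - m b
    alone, which the shift raises by 2, as the section on variation requires of [d]. *)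
Lemma qform_ffshift a b m : a != b ->
  qform (ffshift a b m) = qform m + (m a - m b + 1).
Proof.
move=> ab; have step i : tri (ffshift a b m i) =
    tri (m i) + (i == a)%:R * m a - (i == b)%:R * (m b - 1).
  rewrite ffunE; have [->|ia] := eqVneq i a.
    by rewrite ?eqxx (negbTE ab) /= mul0r mul1r !subr0 triD1.
  have [->|ib] := eqVneq i b; last by rewrite /= !mul0r !addr0 ?subr0.
  rewrite ?eqxx /= mul0r mul1r !addr0; have := triD1 (m b - 1).
  by rewrite subrK => ->; rewrite addrK.
rewrite /qform (eq_bigr _ (fun i _ => step i)) sumrB big_split/= !sum_delta.
by ring.
Qed.

Lemma ffshiftK a b : cancel (ffshift a b) (ffshift b a).
Proof. by move=> m; apply/ffunP => i; rewrite !ffunE; ring. Qed.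

Lemma slice_shift_subproof a b (m : slice k n) : \sum_(i < k) ffshift a b (val m) i == n.
Proof. by rewrite sum_ffshift (valP m). Qed.

Definition slice_shift a b (m : slice k n) : slice k n :=
  Sub (ffshift a b (val m)) (slice_shift_subproof a b m).

Lemma slice_shiftK a b : cancel (slice_shift a b) (slice_shift b a).
Proof. by move=> m; apply/val_inj; exact: ffshiftK. Qed.

Lemma slice_shift_diff a b (m : slice k n) : a != b ->
  val (slice_shift a b m) a - val (slice_shift a b m) b = val m a - val m b + 2.
Proof.
move=> ab; rewrite /= !ffunE !eqxx (negbTE ab) eq_sym (negbTE ab) /=; lia.
Qed.

End Lattice.

(** * Absolute summability of the weights *)

Section Summability.
Variable R : realType.

Lemma geometric_le (r : R) N : 0 < r -> r < 1 -> \sum_(j < N) r ^+ j <= (1 - r)^-1.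
Proof.
move=> r0 r1; have r10 : 0 < 1 - r by rewrite subr_gt0.
rewrite -(ler_pM2l r10) mulfV ?gt_eqF// -opprB mulNr -subrX1 opprB.
by rewrite gerBl exprn_ge0// ltW.
Qed.

(** Since tri x >= |x| - 1, the weight is at most the product of the r^-1 * r ^ |m_i|. A finite set
    of points lies in a box, over which the sum of these products is the k-th power of a
    one-dimensional geometric sum. *)
Lemma abs_summable_qform k n (r : R) : 0 < r -> r < 1 ->
  abs_summable (fun m : slice k n => r ^ qform k (val m)).
Proof.
move=> r0 r1; exists ((2 * (r^-1 / (1 - r))) ^+ k) => J.
pose u (x : int) : R := r^-1 * r ^+ `|x|%N.
have u0 x : 0 <= u x by rewrite mulr_ge0 ?invr_ge0 ?exprn_ge0// ltW.
have tri_u x : r ^ tri x <= u x.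
  have : r ^ tri x <= r ^ (`|x|%N%:Z - 1).
    have d0 : 0 <= tri x - (`|x|%N%:Z - 1) by have := tri2E x; nia.
    rewrite -[tri x](subrK (`|x|%N%:Z - 1)) expfzDr ?gt_eqF// ler_piMl ?exprz_ge0 ?(ltW r0)//.
    by case: (tri x - _) d0 => // d _; rewrite exprn_ile1// ltW.
  by rewrite expfzDr ?gt_eqF// mulrC.
have wu (m : slice k n) : `|r ^ qform k (val m)| <= \prod_(i < k) u (val m i).
  rewrite ger0_norm ?exprz_ge0 ?(ltW r0)// /qform.
  rewrite (big_morph (fun x : int => r ^ x) (id1 := 1) (op1 := *%R))//; last first.
    by move=> x y; rewrite expfzDr ?gt_eqF.
  by apply: ler_prod => i _; rewrite exprz_ge0 ?tri_u// ltW.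
pose N := (\max_(m <- J) \max_(i < k) `|val m i|%N)%N.
have mN (m : slice k n) i : m \in J -> (`|val m i| <= N)%N.
  move=> mJ; apply: (@leq_trans (\max_(i < k) `|val m i|%N)%N).
    exact: (@leq_bigmax _ (fun i => `|val m i|%N)).
  exact: (@leq_bigmax_seq _ _ xpredT (fun m : slice k n => \max_(i < k) `|val m i|%N)%N).
(* An integer is coded by a sign bit and an absolute value. Zero has two codes, which only enlarges
   the upper bound; the sign bit accounts for the factor 2. *)
pose dec (p : bool * 'I_N.+1) : int := if p.1 then p.2%:Z else - p.2%:Z.
pose enc (m : slice k n) : {ffun 'I_k -> bool * 'I_N.+1} :=
  [ffun i => (0 <= val m i, inord `|val m i|)].
have encK (m : slice k n) i : m \in J -> dec (enc m i) = val m i.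
  move=> mJ; rewrite ffunE /dec /= inordK ?ltnS ?mN//.
  by case: (lerP 0 (val m i)) => h; [rewrite gez0_abs|rewrite ltz0_abs// opprK].
have enc_inj : {in J &, injective enc}.
  move=> m1 m2 h1 h2 e; apply/val_inj/ffunP => i.
  by rewrite -!encK// e.
apply: le_trans (ler_psum _ _ _ _ J wu) _.
have -> : psum (fun m : slice k n => \prod_(i < k) u (val m i)) J =
    \sum_(p <- [fset enc m | m in J]%fset) \prod_(i < k) u (dec (p i)).
  rewrite big_imfset//= /psum; apply: eq_big_seq => m mJ.
  by apply: eq_bigr => i _; rewrite encK.
apply: (@le_trans _ _ (\sum_(p : {ffun 'I_k -> bool * 'I_N.+1}) \prod_(i < k) u (dec (p i)))).
  rewrite big_uniq ?fset_uniq//= big_mkcond/=; apply: ler_sum => p _.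
  by case: ifP => // _; apply: prodr_ge0.
rewrite -(bigA_distr_bigA (fun _ p => u (dec p)))/= prodr_const card_ord.
have uN : \sum_(p : bool * 'I_N.+1) u (dec p) = 2 * (r^-1 * \sum_(j < N.+1) r ^+ j).
  rewrite -(pair_bigA _ (fun b j => u (dec (b, j))))/= big_bool/=.
  rewrite mulr_sumr mulr_natl mulr2n; congr (_ + _); apply: eq_bigr => j _;
    by rewrite /u /dec /= ?abszN.
have r10 : 0 < r^-1 by rewrite invr_gt0.
rewrite uN lerXn2r ?nnegrE//.
- by rewrite mulr_ge0 ?mulr_ge0 ?sumr_ge0 ?ltW// => j _; rewrite exprn_ge0// ltW.
- by rewrite mulr_ge0 ?mulr_ge0 ?invr_ge0 ?subr_ge0 ?ltW.
- by rewrite !ler_pM2l//; exact: geometric_le.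
Qed.
End Summability.

(** * Averaging the signs one coordinate at a time *)

Definition qsum (R : realType) (k : nat) (n : int) (q : R) : R :=
  usum (I := slice k n) (fun m => q ^ qform k (val m)).

Arguments qsum {R}.

Section Sign.
Variables (R : realType) (k : nat) (n : int) (r : R) (K : nat).
Hypotheses (r0 : 0 < r) (r1 : r < 1) (K0 : (0 < K)%N).

Let w (m : slice k.+1 n) : R := r ^ qform k.+1 (val m).

(* The product of the signs of all coordinates, once averaged over the first j + 1
   of them. *)
Definition partial_avg (j : nat) (m : slice k.+1 n) : R :=
  tavg R j (\sum_(i < k.+1 | (i <= j)%N) val m i) *
  \prod_(i < k.+1 | (j < i)%N) tsgn R (val m i).

Lemma partial_avg_bound j m : `|partial_avg j m| <= 1.
Proof.
rewrite normrM normr_prod [X in _ * X]big1 ?mulr1 ?tavg_bound// => i _.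
exact: tsgn_norm.
Qed.

Lemma partial_avg0 m : w m * partial_avg 0 m = (- r) ^ qform k.+1 (val m).
Proof.
rewrite -mulN1r expfzMl mulrC; congr (_ * _).
rewrite /qform (big_morph (fun x : int => (-1 : R) ^ x) (id1 := 1) (op1 := *%R))//; last first.
  by move=> x y; rewrite expfzDr// oppr_eq0 oner_eq0.
rewrite big_ord_recl /partial_avg (big_pred1 ord0) /=; last first.
  by move=> i; rewrite leqn0.
by rewrite /= [in RHS]/index_enum [X in _ * X]big_mkcond big_ord_recl /= mul1r.
Qed.

(** No individual sign is left, and the sum of all coordinates is fixed on the slice, so the
    dependence on [m] disappears. *)
Lemma partial_avg_last m : partial_avg k m = tavg R k n.
Proof.
rewrite /partial_avg [X in _ * X]big_pred0 ?mulr1; last first.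
  by move=> i; rewrite ltnNge -ltnS ltn_ord.
congr tavg; rewrite (eq_bigl xpredT); first exact/eqP/(valP m).
by move=> i; rewrite -ltnS ltn_ord.
Qed.

(** The shift raises the sum of the coordinates up to j by 1, through coordinate 0, lowers
    coordinate j + 1 by 1 and fixes the later ones; [tavg_step] then applies. *)
Lemma partial_avgS j m (b : 'I_k.+1) : b = j.+1 :> nat ->
  (partial_avg j m + partial_avg j (slice_shift k.+1 n ord0 b m)) / 2 = partial_avg j.+1 m.
Proof.
move=> bj; have b0 : (ord0 == b) = false by apply/eqP => e; rewrite -e in bj.
rewrite /partial_avg /=.
set p := \sum_(i < k.+1 | (i <= j)%N) val m i.
have -> : \sum_(i < k.+1 | (i <= j)%N) ffshift k.+1 ord0 b (val m) i = p + 1.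
  rewrite (bigD1 ord0)//= ffunE eqxx b0 /= subr0 addrAC /p; congr (_ + 1).
  rewrite [in RHS](bigD1 ord0)//=; congr (_ + _); apply: eq_bigr => i /andP[ij i0].
  rewrite ffunE (negbTE i0) (_ : (i == b) = false) ?addr0 ?subr0//.
  by apply/eqP => e; move: ij; rewrite e bj ltnn.
pose P := \prod_(i < k.+1 | (j.+1 < i)%N) tsgn R (val m i).
have -> : \prod_(i < k.+1 | (j < i)%N) tsgn R (val m i) = tsgn R (val m b) * P.
  rewrite (bigD1 b)/= ?bj//; congr (_ * _); apply: eq_bigl => i.
  by rewrite -val_eqE /= bj; lia.
have -> : \prod_(i < k.+1 | (j < i)%N) tsgn R (ffshift k.+1 ord0 b (val m) i) =
    tsgn R (val m b - 1) * P.
  rewrite (bigD1 b)/= ?bj//; congr (_ * _).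
    by rewrite ffunE eqxx [b == _]eq_sym b0 addr0.
  apply: eq_big => i; first by rewrite -val_eqE /= bj; lia.
  move=> /andP[ji ib]; rewrite ffunE (negbTE ib) (_ : (i == ord0) = false) ?addr0 ?subr0//.
  by apply/eqP => e; rewrite e in ji.
have -> : \sum_(i < k.+1 | (i <= j.+1)%N) val m i = p + val m b.
  rewrite (bigD1 b)/= ?bj// addrC; congr (_ + _); apply: eq_bigl => i.
  by rewrite -val_eqE /= bj; lia.
have := tavg_step R j p (val m b); rewrite /= => <-; rewrite -/P.
by rewrite !mulrA -!mulrDl [LHS]mulrAC.
Qed.

(** The k averaging steps each cost one error term of [shift_average], and the triangle inequality
    adds them up. *)
Lemma qsum_sign :
  `|qsum k.+1 n (- r) - tavg R k n * qsum k.+1 n r| <=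
    k%:R * ((2 / K%:R + (r ^- K - 1)) * qsum k.+1 n r).
Proof.
have sw : abs_summable w by exact: abs_summable_qform.
have w0 m : 0 <= w m by rewrite exprz_ge0// ltW.
have H j : (j <= k)%N -> `|usum (fun m => w m * partial_avg 0 m) -
    usum (fun m => w m * partial_avg j m)| <=
    j%:R * ((2 / K%:R + (r ^- K - 1)) * qsum k.+1 n r).
  elim: j => [|j IH] jk; first by rewrite subrr normr0 mul0r.
  rewrite -natr1 mulrDl mul1r.
  set b : 'I_k.+1 := Ordinal (jk : (j.+1 < k.+1)%N).
  have b0 : ord0 != b by [].
  have st := slice_shiftK k.+1 n ord0 b.
  have ts := slice_shiftK k.+1 n b ord0.
  have ws m : w (slice_shift k.+1 n ord0 b m) = w m * r ^ (val m ord0 - val m b + 1).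
    by rewrite /w /= qform_ffshift// expfzDr ?gt_eqF.
  have ds m := slice_shift_diff k.+1 n ord0 b m b0.
  have := shift_average _ _ r K w (fun m => val m ord0 - val m b) _ _ r0 r1 K0 w0 sw
     st ts ws ds (partial_avg j) (partial_avg_bound j).
  have -> : (fun m => w m * ((partial_avg j m + partial_avg j (slice_shift k.+1 n ord0 b m)) / 2)) =
     (fun m => w m * partial_avg j.+1 m).
    by apply/funext => m; rewrite (partial_avgS _ _ b).
  move=> h; apply: le_trans (lerD (IH (ltnW jk)) h).
  exact: ler_distD.
have := H k (leqnn k).
rewrite (_ : (fun m => w m * partial_avg 0 m) = fun m => (- r) ^ qform k.+1 (val m)); last first.
  by apply/funext => m; rewrite partial_avg0.
rewrite (_ : (fun m => w m * partial_avg k m) = fun m => tavg R k n * w m); last first.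
  by apply/funext => m; rewrite partial_avg_last mulrC.
by rewrite usumZ.
Qed.
End Sign.

(** * The real function [qsum]: lower bound, negative values, continuity *)

Section Real.
Variable R : realType.

Lemma expr_qform_le k (m : {ffun 'I_k -> int}) (q rho : R) : `|q| <= rho ->
  `|q ^ qform k m| <= rho ^ qform k m.
Proof.
move=> qr; have := qform_ge0 k m; case: (qform k m) => // N _.
by rewrite -!exprnP normrX lerXn2r ?nnegrE//; exact: le_trans qr.
Qed.

Lemma qsum_ge1 (k n : nat) (q : R) : (n <= k)%N -> 0 <= q -> q < 1 ->
  1 <= qsum k n q.
Proof.
move=> nk q0 q1.
(* The point with n ones followed by k - n zeros has exponent 0 and contributes 1. *)
pose m0 : {ffun 'I_k -> int} := [ffun i : 'I_k => (i < n)%N%:R].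
have hm0 : \sum_(i < k) m0 i == n%:Z.
  under eq_bigr do rewrite ffunE.
  rewrite -natr_sum -(big_mkord xpredT (fun i => nat_of_bool (i < n)%N)).
  rewrite (big_cat_nat (leq0n n) nk)//= big_nat_cond (eq_bigr (fun=> 1%N)); last first.
    by move=> i; rewrite andbT => /andP[_ ->].
  rewrite -big_nat_cond sum_nat_const_nat subn0 muln1.
  rewrite [X in (_ + X)%N]big_nat_cond [X in (_ + X)%N]big1 ?addn0 ?pmulrn ?intz//.
  by move=> i; rewrite andbT => /andP[ni _]; rewrite ltnNge ni.
have Q0 : qform k m0 = 0.
  by rewrite /qform big1// => i _; rewrite ffunE; case: (i < n)%N.
(* Summability is known for bases in ]0, 1[, and q may be 0, hence the comparison with a larger
   base. *)
pose rho : R := (1 + q) / 2.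
have [rho0 rho1 qrho] : [/\ 0 < rho, rho < 1 & `|q| <= rho].
  by rewrite /rho ger0_norm//; split; lra.
have sq : abs_summable (fun m : slice k n => q ^ qform k (val m)).
  apply: (abs_summable_le _ _ _ _ (abs_summable_qform _ k n rho rho0 rho1)) => m.
  exact: expr_qform_le.
have := psum_le_usum _ _ _ [fset (Sub m0 hm0 : slice k n)]%fset sq.
rewrite /psum big_seq_fset1 /= Q0 expr0z; apply=> m.
by rewrite exprz_ge0.
Qed.

Lemma one_sub_exprn_ge (t : R) K : 0 <= t -> t <= 1 -> 1 - K%:R * t <= (1 - t) ^+ K.
Proof.
move=> t0 t1; elim: K => [|K IH]; first by rewrite mul0r subr0 expr0.
rewrite exprS -natr1; apply: (@le_trans _ _ ((1 - t) * (1 - K%:R * t))).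
  have : 0 <= K%:R * t * t by rewrite !mulr_ge0.
  nra.
by rewrite ler_wpM2l// subr_ge0.
Qed.

Lemma exprVn_near1 K (e : R) : (0 < K)%N -> 0 < e ->
  exists r : R, [/\ 0 < r, r < 1 & r ^- K <= 1 + e].
Proof.
move=> K0 e0; have KR : 1 <= K%:R :> R by rewrite ler1n.
have K0R : 0 < K%:R :> R by rewrite ltr0n.
(* Chosen so that 1 - K t = 1 / (1 + e), which Bernoulli's inequality compares with (1 - t) ^ K. *)
pose t : R := e / (K%:R * (1 + e)).
have den : 0 < K%:R * (1 + e) by rewrite mulr_gt0//; lra.
have t0 : 0 < t by rewrite divr_gt0.
have t1 : t < 1 by rewrite ltr_pdivrMr// mul1r; nra.
have Kt : 1 - K%:R * t = (1 + e)^-1.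
  by rewrite /t; field; rewrite ?gt_eqF//; lra.
exists (1 - t); split; [lra|lra|].
rewrite -[leRHS]invrK lef_pV2 ?posrE ?invr_gt0 ?exprn_gt0//; [|lra|lra].
by rewrite -Kt one_sub_exprn_ge ?ltW.
Qed.

Lemma qsum_neg (k n : nat) : (0 < k)%N -> (n <= k)%N -> tavg R k.-1 n < 0 ->
  exists r : R, [/\ 0 < r, r < 1 & qsum k n (- r) < 0].
Proof.
case: k => // k _ nk; rewrite [k.+1.-1]/=; set c := tavg R k n => c0.
(* Both 2 / K and r ^- K - 1 will be at most e, so the total error relative to [qsum] at r is at
   most -c / 2, leaving the negative factor c / 2. *)
pose e : R := - c / (4 * k.+1%:R).
have kR : 0 < k.+1%:R :> R by rewrite ltr0n.
have e0 : 0 < e by rewrite divr_gt0 ?oppr_gt0 ?mulr_gt0.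
pose K := (Num.truncn (2 / e)).+1.
have K0 : (0 < K)%N by [].
have KE : 2 / K%:R < e.
  rewrite ltr_pdivrMr ?ltr0n// mulrC -ltr_pdivrMr//.
  exact: truncnS_gt.
have [r [r0 r1 rK]] := exprVn_near1 K e K0 e0.
exists r; split=> //.
have T1 := qsum_ge1 k.+1 n r nk (ltW r0) r1.
have := qsum_sign R k n r K r0 r1 K0; rewrite -/c ler_norml => /andP[_].
set T := qsum _ _ r in T1 *; rewrite lerBlDl => h; apply: (le_lt_trans h).
rewrite mulrA -mulrDl nmulr_rlt0 ?(lt_le_trans ltr01)//.
have : k%:R * (2 / K%:R + (r ^- K - 1)) <= k.+1%:R * (2 * e).
  apply: (@le_trans _ _ (k%:R * (2 * e))); first by rewrite ler_wpM2l//; lra.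
  by rewrite ler_wpM2r ?ler_nat//; lra.
have -> : k.+1%:R * (2 * e) = - c / 2.
  by rewrite /e; move: (lt0r_neq0 kR); move: (k.+1%:R) => x x0; field.
lra.
Qed.

(** On |q| <= rho the sum is within e / 3 of one polynomial, its partial sum over a finite set
    independent of q. *)
Lemma qsum_continuous k n (q0 : R) : `|q0| < 1 -> {for q0, continuous (qsum k n)}.
Proof.
move=> q01; pose rho := (1 + `|q0|) / 2.
have [rho0 rho1 q0rho] : [/\ 0 < rho, rho < 1 & `|q0| < rho].
  by have := normr_ge0 q0; rewrite /rho; split; lra.
have sr := abs_summable_qform _ k n rho rho0 rho1.
apply/cvgrPdist_le => e e0; have e3 : 0 < e / 3 by rewrite divr_gt0.
have [J HJ] := usum_tail _ _ _ _ sr e3.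
have tail (q : R) : `|q| <= rho -> `|qsum k n q -
    psum (fun m : slice k n => q ^ qform k (val m)) J| <= e / 3.
  by move=> qr; apply: HJ => m; exact: expr_qform_le.
have pc : continuous (fun q : R => psum (fun m : slice k n => q ^ qform k (val m)) J).
  have -> : (fun q : R => psum (fun m : slice k n => q ^ qform k (val m)) J) =
      horner (\sum_(m <- J) 'X^(`|qform k (val m)|)).
    apply/funext => q; rewrite horner_sum; apply: eq_bigr => m _.
    by rewrite hornerXn -[in LHS](gez0_abs (qform_ge0 _ _)).
  exact: continuous_horner.
have /cvgrPdist_le/(_ _ e3) h1 := pc q0.
have h2 : \forall q \near q0, `|q| <= rho by exact: (@cvgr_norm_le R R^o R (nbhs q0) _ id q0 cvg_id).
near=> q.
have /tail : `|q| <= rho by near: q.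
have : `|psum (fun m : slice k n => q0 ^ qform k (val m)) J -
    psum (fun m : slice k n => q ^ qform k (val m)) J| <= e / 3 by near: q.
have := tail _ (ltW q0rho); rewrite !ler_norml; lra.
Unshelve. all: by end_near.
Qed.

End Real.

(** * Passage to the complex sum, congruences and conclusion *)

Lemma sum_realC (R : realType) (I : choiceType) (f : I -> R) : abs_summable f ->
  summability.sum (R := R[i]^o) (fun i => (f i)%:C) = (usum f)%:C.
Proof.
move=> sf; apply: (cvg_lim (@norm_hausdorff _ _)).
(* In [R[i]] a positive e has zero imaginary part, so its real part serves as the real tolerance. *)
apply/cvgrPdist_le => e; rewrite ltcE /= => /andP[/eqP Ime e0].
have /cvgrPdist_le/(_ _ e0) := usum_cvg _ _ _ sf.
apply: filterS => J h.
rewrite /summability.partial_sum.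
rewrite -(big_seq_fsetE _ J xpredT (fun i => (f i)%:C)) -rmorph_sum/= -rmorphB/= normc_def/= expr0n addr0 sqrtr_sqr.
by rewrite lecE/= Ime eqxx.
Qed.

Lemma gamma_qsum (R : realType) (k : nat) (n : int) (q : R) : `|q| < 1 ->
  gamma k n q%:C = (qsum k n q)%:C.
Proof.
move=> q1; rewrite -sum_realC.
  apply: (congr1 (summability.sum (R := R[i]^o))); apply/funext => m.
  rewrite (qformE k (val m)); have := qform_ge0 k (val m).
  by case: (qform k (val m)) => // N _; rewrite -!exprnP rmorphXn.
have [rho0 rho1 qrho] : [/\ 0 < (1 + `|q|) / 2, (1 + `|q|) / 2 < 1 & `|q| <= (1 + `|q|) / 2].
  by have := normr_ge0 q; split; lra.
apply: (abs_summable_le _ _ _ _ (abs_summable_qform _ k n _ rho0 rho1)) => m.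
exact: expr_qform_le.
Qed.

(** As 2n modulo 8 depends only on n modulo 4, the equivalence of the conditions becomes a check of
    32 pairs of residues. *)
Lemma sub_double_mod8 (k n : nat) :
  ((k%:Z - 2 * n%:Z) %% 8)%Z = (((k %% 8)%N%:Z - 2 * (n %% 4)%N%:Z) %% 8)%Z.
Proof.
rewrite [in LHS](divn_eq k 8) [in LHS](divn_eq n 4) !PoszD !PoszM.
rewrite -[RHS](modzMDl ((k %/ 8)%N%:Z - (n %/ 4)%N%:Z)).
by congr (_ %% _)%Z; ring.
Qed.

Lemma cases_mod8 (k n : nat) :
  case_a k n \/ case_b k n \/ case_c k n \/ case_d k n <->
     (k%:Z - 2 * n%:Z = 3 %[mod 8])%Z \/
     (k%:Z - 2 * n%:Z = 4 %[mod 8])%Z \/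
     (k%:Z - 2 * n%:Z = 5 %[mod 8])%Z.
Proof.
rewrite /case_a /case_b /case_c /case_d sub_double_mod8.
have : (n %% 4 < 4)%N by rewrite ltn_mod.
have : (k %% 8 < 8)%N by rewrite ltn_mod.
move: (n %% 4)%N (k %% 8)%N => a b b8 a4; split.
  by move=> [[-> [|[]]->]|[[-> [|[]]->]|[[-> [|[]]->]|[-> [|[]]->]]]];
    first [by left|by right; left|by right; right].
case: a a4 => [|[|[|[|//]]]] _; case: b b8 => [|[|[|[|[|[|[|[|//]]]]]]]] _ h.
all: first [by move: h => [/eqP|[/eqP|/eqP]]
  | by left; split; auto | by right; left; split; auto
  | by right; right; left; split; auto | by right; right; right; split; auto].
Qed.

Theorem corollary2 (R : realType) (k n : nat) (hk : (2 <= k)%N)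
    (hn : (n <= k)%N) :
  (case_a k n \/ case_b k n \/ case_c k n \/ case_d k n ->
     exists q : R, -1 < q < 0 /\ gamma k n%:Z q%:C = 0) /\
  (case_a k n \/ case_b k n \/ case_c k n \/ case_d k n <->
     (k%:Z - 2 * n%:Z = 3 %[mod 8])%Z \/
     (k%:Z - 2 * n%:Z = 4 %[mod 8])%Z \/
     (k%:Z - 2 * n%:Z = 5 %[mod 8])%Z).
Proof.
split; last exact: cases_mod8.
move=> /cases_mod8 hkn.
have [r [r0 r1 Fr]] := qsum_neg R k n (ltnW hk) hn (tavg_neg R k n (ltnW hk) hkn).
have F0 := qsum_ge1 R k n 0 hn (lexx _) ltr01.
have cF : {within `[- r, 0], continuous (qsum k n : R -> R)}%classic.
  apply: continuous_in_subspaceT => x; rewrite inE/= in_itv/= => /andP[rx x0].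
  by apply: qsum_continuous; rewrite ler0_norm//; lra.
have [||c] := @IVT R _ (- r) 0 0 _ cF; first by rewrite oppr_le0 ltW.
  by rewrite ge_min le_max (ltW Fr) (le_trans ler01 F0) orbT.
rewrite in_itv/= => /andP[rc c0] Fc; exists c.
(* The zero given on [-r, 0] is not the endpoint 0, where the value is at least 1. *)
have cN0 : c != 0 by apply/eqP => c00; move: F0; rewrite -c00 Fc ler10.
have cneg : c < 0 by rewrite lt_neqAle cN0.
split; first by rewrite cneg andbT; lra.
by rewrite gamma_qsum ?Fc// ler0_norm//; lra.
Qed.
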